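(* Consider the Riccati equation $$x^2\frac{dy}{dx}+(1+ax)y=bx^2+y^2$$ with parameters $(a,b)\in\mathbb R^2$. Then there is a neighborhood $U\subset\mathbb R^2$ of $(a,b)=(-2,0)$ in the $(a,b)$-parameter space such that the formal series expansion of the center manifold $\phi=\sum_{n=2}^\infty\phi_nx^n\in x^2\mathbb C[[x]]$ of the Riccati equation with $(a,b)\in U$ is convergent if and only if either of the following conditions holds: (1) $b=0$; (2) $a=-b-2$.
   Context: The formal series expansion of the center manifold is the unique formal power series $\phi\in x\mathbb C[[x]]$ without constant term satisfying $x^2\phi'(x)+(1+ax)\phi(x)=bx^2+\phi(x)^2$ as an identity of formal power series (it automatically lies in $x^2\mathbb C[[x]]$). Convergent means having positive radius of convergence. *)

(* Defs.v *)
From Stdlib Require Import Reals Lra Lia Arith.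
From Coquelicot Require Import Coquelicot.

(* Formal power series over C; two of them are identified when all their
   coefficients agree. *)
Definition fps := nat -> C.

Declare Scope fps_scope.
Delimit Scope fps_scope with fps.
Bind Scope fps_scope with fps.

Definition fps_eq (f g : fps) : Prop := forall n, f n = g n.

Definition fps_const (c : C) : fps :=
  fun n => match n with O => c | _ => 0%C end.

Definition fps_X : fps := fun n => match n with 1%nat => 1%C | _ => 0%C end.

Definition fps_add (f g : fps) : fps := fun n => (f n + g n)%C.

Definition fps_mul (f g : fps) : fps :=
  fun n => sum_n (fun k => (f k * g (n - k)%nat)%C) n.

Definition fps_deriv (f : fps) : fps := fun n => (RtoC (INR (S n)) * f (S n))%C.

Infix "+" := fps_add : fps_scope.
Infix "*" := fps_mul : fps_scope.
Infix "==" := fps_eq (at level 70, no associativity) : fps_scope.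

(* [CV_radius] is only available for real coefficient sequences; the radius of
   convergence of a complex power series is that of the series of moduli. *)
Definition fps_radius (f : fps) : Rbar := CV_radius (fun n => Cmod (f n)).

Definition fps_convergent (f : fps) : Prop := Rbar_lt 0 (fps_radius f).

Definition center_manifold_series (a b : R) (phi : fps) : Prop :=
  phi 0%nat = RtoC 0 /\
  (fps_X * fps_X * fps_deriv phi
     + (fps_const (RtoC 1) + fps_const (RtoC a) * fps_X) * phi
   == fps_const (RtoC b) * (fps_X * fps_X) + phi * phi)%fps.

(* The remaining lemmas show that [center_manifold_series a b] has exactly one
   solution, which lies in x^2 C[[x]]. *)

Lemma Csum_0 (u : nat -> C) n :
  (forall k, (k <= n)%nat -> u k = RtoC 0) -> sum_n u n = RtoC 0.
Proof.
induction n as [|n IH]; intros H.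
- rewrite sum_O. apply H. lia.
- rewrite sum_Sn, IH, H; [apply Cplus_0_l | lia | intros; apply H; lia].
Qed.

Lemma Csum_first (u : nat -> C) n :
  (forall k, (k < n)%nat -> u (S k) = RtoC 0) -> sum_n u n = u 0%nat.
Proof.
induction n as [|n IH]; intros H.
- apply sum_O.
- rewrite sum_Sn, IH, H; [apply Cplus_0_r | lia | intros; apply H; lia].
Qed.

Lemma fps_mul_ext f f' g g' n :
  (forall k, (k <= n)%nat -> f k = f' k) ->
  (forall k, (k <= n)%nat -> g k = g' k) ->
  fps_mul f g n = fps_mul f' g' n.
Proof.
intros Hf Hg. apply sum_n_ext_loc. intros k Hk. rewrite Hf, Hg; auto; lia.
Qed.

Lemma fps_mul_const c f n : fps_mul (fps_const c) f n = (c * f n)%C.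
Proof.
unfold fps_mul. rewrite Csum_first.
- simpl. now rewrite Nat.sub_0_r.
- intros k _. simpl. ring.
Qed.

Lemma fps_mul_X_0 f : fps_mul fps_X f 0%nat = RtoC 0.
Proof. unfold fps_mul. rewrite sum_O. simpl. ring. Qed.

Lemma fps_mul_X_S f n : fps_mul fps_X f (S n) = f n.
Proof.
unfold fps_mul. induction n as [|n IH].
- rewrite sum_Sn, sum_O. unfold plus; simpl. ring.
- rewrite <- (Cplus_0_l (f (S n))). unfold sum_n.
  rewrite sum_Sn_m by lia. simpl (fps_X 0%nat). rewrite Cmult_0_l.
  change (plus (RtoC 0)) with (Cplus (RtoC 0)). f_equal.
  rewrite <- sum_n_m_S.
  change (sum_n (fun k => (fps_X (S k) * f (S (S n) - S k)%nat)%C) (S n)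
          = f (S n)).
  rewrite Csum_first.
  + simpl. ring.
  + intros k _. simpl. ring.
Qed.

Lemma fps_mul_addl f g h n :
  fps_mul (fps_add f g) h n = (fps_mul f h n + fps_mul g h n)%C.
Proof.
unfold fps_mul, fps_add. symmetry. etransitivity.
- symmetry. apply (@sum_n_plus C_AbelianMonoid).
- apply sum_n_ext. intros k. unfold plus; simpl. ring.
Qed.

Lemma fps_mul_X2 f n : fps_mul (fps_mul fps_X fps_X) f n =
  match n with S (S m) => f m | _ => RtoC 0 end.
Proof.
assert (HX : forall k, fps_mul fps_X fps_X k =
               match k with 2%nat => RtoC 1 | _ => RtoC 0 end).
{ intros [|[|[|k]]]; rewrite ?fps_mul_X_0, ?fps_mul_X_S; reflexivity. }
rewrite (fps_mul_ext _ (fun k => match k with 2%nat => RtoC 1 | _ => RtoC 0 end)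
           f f n); auto.
unfold fps_mul. destruct n as [|[|n]].
- rewrite sum_O. ring.
- rewrite sum_Sn, sum_O. unfold plus; simpl. ring.
- transitivity (fps_mul fps_X f (S n)).
  2: apply fps_mul_X_S.
  unfold fps_mul, sum_n at 1. rewrite sum_Sn_m by lia.
  rewrite Cmult_0_l, <- sum_n_m_S.
  change (plus (RtoC 0)) with (Cplus (RtoC 0)). rewrite Cplus_0_l.
  apply sum_n_ext. intros [|[|k]]; reflexivity.
Qed.

Lemma fps_mul_aX a f n : fps_mul (fps_mul (fps_const a) fps_X) f (S n) = (a * f n)%C.
Proof.
rewrite <- (fps_mul_X_S f n), <- (fps_mul_const a).
rewrite (fps_mul_const a). unfold fps_mul at 1.
etransitivity.
- apply (sum_n_ext _ (fun k => mult (a : C_Ring) (fps_X k * f (S n - k)%nat)%C)).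
  intros k. rewrite fps_mul_const. symmetry. apply Cmult_assoc.
- apply (@sum_n_mult_l C_Ring).
Qed.

Definition delta2 (n : nat) : C := match n with 2%nat => RtoC 1 | _ => RtoC 0 end.

Lemma center_manifold_seriesP a b phi :
  center_manifold_series a b phi <->
  phi 0%nat = RtoC 0 /\
  forall n, phi (S n) =
    (RtoC b * delta2 (S n) + fps_mul phi phi (S n)
     - (RtoC (INR n) + RtoC a) * phi n)%C.
Proof.
assert (HL : forall n, fps_add (fps_mul (fps_mul fps_X fps_X) (fps_deriv phi))
   (fps_mul (fps_add (fps_const (RtoC 1)) (fps_mul (fps_const (RtoC a)) fps_X)) phi)
   (S n) = (phi (S n) + (RtoC (INR n) + RtoC a) * phi n)%C).
{ intros n. unfold fps_add at 1.
  rewrite fps_mul_X2, fps_mul_addl, fps_mul_const, fps_mul_aX.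
  destruct n as [|n].
  - simpl INR. ring.
  - unfold fps_deriv. ring. }
assert (HR : forall n, fps_add (fps_mul (fps_const (RtoC b)) (fps_mul fps_X fps_X))
   (fps_mul phi phi) (S n) = (RtoC b * delta2 (S n) + fps_mul phi phi (S n))%C).
{ intros n. unfold fps_add. rewrite fps_mul_const, fps_mul_X_S.
  now destruct n as [|[|n]]. }
split; intros [H0 H]; split; auto; intros n.
- specialize (H (S n)). rewrite HL, HR in H. rewrite <- H. ring.
- destruct n as [|n].
  + unfold fps_add at 1. rewrite fps_mul_X2, fps_mul_addl, fps_mul_const.
    unfold fps_add. rewrite fps_mul_const, fps_mul_X_0.
    unfold fps_mul. rewrite !sum_O, !Nat.sub_diag, H0. ring.
  + rewrite HL, HR, H. ring.
Qed.

(* Since the constant term vanishes, the coefficient of x^(n+1) in phi^2 only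
   involves the coefficients of phi up to order n. *)
Lemma fps_sqr_ext f g n :
  f 0%nat = RtoC 0 -> g 0%nat = RtoC 0 ->
  (forall k, (k <= n)%nat -> f k = g k) -> fps_mul f f (S n) = fps_mul g g (S n).
Proof.
intros Hf Hg H. apply sum_n_ext_loc. intros k Hk.
destruct k as [|k].
- rewrite Hf, Hg. change (RtoC 0 * f (S n - 0)%nat = RtoC 0 * g (S n - 0)%nat)%C.
  ring.
- destruct (Nat.eq_dec k n) as [->|Hkn].
  + rewrite Nat.sub_diag, Hf, Hg.
    change (f (S n) * RtoC 0 = g (S n) * RtoC 0)%C. ring.
  + rewrite !H by lia. reflexivity.
Qed.

Fixpoint center_manifold_approx (a b : R) (N : nat) : fps :=
  match N with
  | O => fun _ => RtoC 0
  | S N' => let f := center_manifold_approx a b N' in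
      fun m => if Nat.eqb m N then
          (RtoC b * delta2 N + fps_mul f f N - (RtoC (INR N') + RtoC a) * f N')%C
        else f m
  end.

Lemma center_manifold_approx_stable a b N m : (m <= N)%nat ->
  center_manifold_approx a b N m = center_manifold_approx a b m m.
Proof.
induction N as [|N IH]; intros Hm.
- now replace m with 0%nat by lia.
- destruct (Nat.eq_dec m (S N)) as [->|Hne]; auto.
  simpl center_manifold_approx at 1.
  destruct (Nat.eqb_spec m (S N)); [easy|]. apply IH. lia.
Qed.

Theorem center_manifold_series_exists a b :
  exists phi, center_manifold_series a b phi.
Proof.
exists (fun n => center_manifold_approx a b n n).
apply center_manifold_seriesP. split; [reflexivity|]. intros n.
simpl center_manifold_approx at 1. rewrite Nat.eqb_refl.
rewrite (fps_sqr_ext _ (fun n => center_manifold_approx a b n n) n); auto.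
- now rewrite center_manifold_approx_stable by lia.
- intros k Hk. now apply center_manifold_approx_stable.
Qed.

Theorem center_manifold_series_unique a b phi psi :
  center_manifold_series a b phi -> center_manifold_series a b psi ->
  (phi == psi)%fps.
Proof.
intros [H0 H]%center_manifold_seriesP [K0 K]%center_manifold_seriesP.
assert (HN : forall N n, (n <= N)%nat -> phi n = psi n).
{ induction N as [|N IH]; intros n Hn.
  - replace n with 0%nat by lia. congruence.
  - destruct (Nat.eq_dec n (S N)) as [->|Hne]; [|apply IH; lia].
    rewrite H, K, (fps_sqr_ext phi psi), (IH N); auto. }
intros n. now apply (HN n).
Qed.

Theorem center_manifold_series_order a b phi :
  center_manifold_series a b phi -> phi 0%nat = RtoC 0 /\ phi 1%nat = RtoC 0.
Proof.
intros [H0 H]%center_manifold_seriesP. split; auto.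
rewrite H. unfold fps_mul. rewrite sum_Sn, sum_O. simpl. rewrite H0.
unfold plus; simpl. ring.
Qed.

(* Main.v *)
Require Import Defs.
From Stdlib Require Import Reals Lra Lia.
From Coquelicot Require Import Coquelicot.

Local Open Scope R_scope.

(** With [phi = x^2 psi] and [y = - x^2 u' / u], i.e. [u' = - psi u], the
    Riccati equation becomes the linear equation
    [x^2 u'' + (1 + (a+2) x) u' + b u = 0], whose series solution with
    [u_0 = 1] satisfies
    [(n+1) u_(n+1) = - (n^2 + (a+1) n + b) u_n].
    If [phi] converges, then [u' = - psi u] forces [|u_n| <= T^n] for some [T];
    but the ratio [u_(n+1)/u_n] is unbounded unless some
    [n^2 + (a+1) n + b] vanishes.  Near [(-2, 0)] this is only possible for
    [n = 0], that is [b = 0], or [n = 1], that is [a = - b - 2].  In both cases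
    [phi = b x^2 / (1 - b x)]. *)

(** * Product laws and the Leibniz rule for formal power series *)

Definition fps_shift (f : fps) : fps := fun n => f (S n).

Lemma fps_mul_Sl f g n :
  fps_mul f g (S n) = (f 0%nat * g (S n) + fps_mul (fps_shift f) g n)%C.
Proof.
unfold fps_mul, sum_n at 1. rewrite sum_Sn_m by lia.
rewrite <- sum_n_m_S. reflexivity.
Qed.

Lemma fps_mul_Sr f g n :
  fps_mul f g (S n) = (fps_mul f (fps_shift g) n + f (S n) * g 0%nat)%C.
Proof.
unfold fps_mul. rewrite sum_Sn, Nat.sub_diag.
change (@plus C_AbelianMonoid) with Cplus. f_equal.
apply sum_n_ext_loc. intros k Hk. unfold fps_shift.
now rewrite Nat.sub_succ_l.
Qed.

Lemma fps_mul_0 f g : fps_mul f g 0%nat = (f 0%nat * g 0%nat)%C.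
Proof. apply sum_O. Qed.

Lemma fps_mul_scall c f g n :
  fps_mul (fun k => c * f k)%C g n = (c * fps_mul f g n)%C.
Proof.
revert f; induction n as [|n IH]; intros f.
- rewrite !fps_mul_0. ring.
- rewrite !fps_mul_Sl.
  change (fps_shift (fun k => c * f k)%C) with (fun k => c * fps_shift f k)%C.
  rewrite IH. ring.
Qed.

Lemma fps_mul_scalr c f g n :
  fps_mul f (fun k => c * g k)%C n = (c * fps_mul f g n)%C.
Proof.
revert f; induction n as [|n IH]; intros f.
- rewrite !fps_mul_0. ring.
- rewrite !fps_mul_Sl, IH. ring.
Qed.

Lemma fps_mul_assoc f g h n :
  fps_mul (fps_mul f g) h n = fps_mul f (fps_mul g h) n.
Proof.
revert f g; induction n as [|n IH]; intros f g.
- rewrite !fps_mul_0. ring.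
- rewrite (fps_mul_Sl (fps_mul f g)), (fps_mul_Sl f (fps_mul g h)).
  rewrite (fps_mul_ext (fps_shift (fps_mul f g))
    (fps_add (fun k => f 0%nat * fps_shift g k)%C (fps_mul (fps_shift f) g)) h h);
    auto.
  + rewrite fps_mul_addl, fps_mul_scall, IH, (fps_mul_Sl g), fps_mul_0. ring.
  + intros k _. apply fps_mul_Sl.
Qed.

Lemma fps_deriv_mul f g n :
  fps_deriv (fps_mul f g) n
  = (fps_mul (fps_deriv f) g n + fps_mul f (fps_deriv g) n)%C.
Proof.
revert f; induction n as [|n IH]; intros f.
- unfold fps_deriv at 1. rewrite fps_mul_Sl, !fps_mul_0.
  unfold fps_deriv, fps_shift. simpl INR. ring.
- unfold fps_deriv at 1. rewrite fps_mul_Sl.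
  rewrite (fps_mul_Sl f (fps_deriv g)).
  assert (Hn : (RtoC (INR (S (S n))) = RtoC (INR (S n)) + RtoC 1)%C)
    by now rewrite <- RtoC_plus, <- S_INR.
  (* Writing f = f_0 + x s with s = [fps_shift f] gives f' = s + x s', which passes the induction
     from f to s. *)
  assert (HD : fps_mul (fps_deriv f) g (S n)
    = (fps_mul (fps_shift f) g (S n) + fps_mul (fps_deriv (fps_shift f)) g n)%C).
  { rewrite <- (fps_mul_X_S (fps_mul _ g) n), <- fps_mul_assoc, <- fps_mul_addl.
    apply fps_mul_ext; auto. intros [|k] _; unfold fps_add.
    - rewrite fps_mul_X_0. unfold fps_deriv, fps_shift. simpl INR. ring.
    - rewrite fps_mul_X_S. unfold fps_deriv, fps_shift.
      rewrite (S_INR (S k)), RtoC_plus. ring. }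
  rewrite HD. specialize (IH (fps_shift f)).
  unfold fps_deriv at 1 in IH.
  transitivity (f 0%nat * fps_deriv g (S n) + fps_mul (fps_shift f) g (S n)
     + RtoC (INR (S n)) * fps_mul (fps_shift f) g (S n))%C.
  + unfold fps_deriv. rewrite Hn. ring.
  + rewrite IH. ring.
Qed.

(** * The equation for psi = phi / x^2 *)

Lemma fps_sqr_shift2 phi n : phi 0%nat = RtoC 0 -> phi 1%nat = RtoC 0 ->
  fps_mul phi phi (S (S n)) =
  match n with
  | S (S m) => fps_mul (fps_shift (fps_shift phi)) (fps_shift (fps_shift phi)) m
  | _ => RtoC 0
  end.
Proof.
intros H0 H1. rewrite !fps_mul_Sl.
assert (S0 : fps_shift phi 0%nat = RtoC 0) by exact H1.
rewrite H0, S0.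
destruct n as [|[|n]]; rewrite ?fps_mul_Sr, ?fps_mul_0, ?H0, ?S0; ring.
Qed.

(** Substituting phi = x^2 psi and dividing by x^2 gives x^2 psi' + (1 + (a+2) x) psi = b + x^2
    psi^2, read here coefficient by coefficient. *)
Lemma center_manifold_seriesP2 a b phi :
  center_manifold_series a b phi <->
  phi 0%nat = RtoC 0 /\ phi 1%nat = RtoC 0 /\
  let psi := fps_shift (fps_shift phi) in
  psi 0%nat = RtoC b /\
  psi 1%nat = (- (RtoC a + 2) * RtoC b)%C /\
  forall n, psi (S (S n)) =
    (fps_mul psi psi n - (RtoC a + 2) * psi (S n) - fps_deriv psi n)%C.
Proof.
set (psi := fps_shift (fps_shift phi)).
assert (Hpsi : forall n, psi n = phi (S (S n))) by reflexivity.
assert (Hc : forall n, (RtoC (INR (S (S (S n)))) + RtoC a)%C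
                     = (RtoC (INR (S n)) + (RtoC a + 2))%C).
{ intros n. rewrite <- !RtoC_plus, !(S_INR (S _)). f_equal. ring. }
assert (H2 : phi 0%nat = RtoC 0 -> phi 1%nat = RtoC 0 ->
  forall n, fps_mul phi phi (S (S n)) =
    match n with S (S m) => fps_mul psi psi m | _ => RtoC 0 end).
{ intros H0 H1 n. now apply fps_sqr_shift2. }
split.
- intros H. destruct (center_manifold_series_order _ _ _ H) as [H0 H1].
  apply center_manifold_seriesP in H. destruct H as [_ H].
  specialize (H2 H0 H1).
  assert (P0 : phi 2%nat = RtoC b).
  { rewrite H, H2, H1. simpl. ring. }
  repeat split; auto.
  + rewrite Hpsi, H, H2, P0. simpl.
    replace (RtoC (1 + 1)) with (RtoC 2) by (f_equal; ring). ring.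
  + intros n. rewrite Hpsi, H, H2, Hc. unfold fps_deriv. rewrite !Hpsi.
    simpl delta2. ring.
- intros (H0 & H1 & P0 & P1 & H). rewrite Hpsi in P0, P1.
  specialize (H2 H0 H1).
  apply center_manifold_seriesP. split; auto.
  intros [|[|[|n]]].
  + rewrite H1, fps_mul_Sr, fps_mul_0, H0. simpl. ring.
  + rewrite P0, H2, H1. simpl. ring.
  + rewrite P1, H2, P0. simpl.
    replace (RtoC (1 + 1)) with (RtoC 2) by (f_equal; ring). ring.
  + rewrite H2, <- !Hpsi, H, Hc. unfold fps_deriv.
    simpl delta2. ring.
Qed.

(** * The associated linear equation *)

(** Eigenvalue on x^n of the Euler operator u -> x^2 u'' + (a+2) x u' + b u; the linear equation
    reads u' = - (this operator applied to u). *)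
Definition indicial (a b : R) (n : nat) : R := INR n * INR n + (a + 1) * INR n + b.

Fixpoint linear_sol (a b : R) (n : nat) : R :=
  match n with
  | O => 1
  | S m => - (indicial a b m / INR (S m)) * linear_sol a b m
  end.

Lemma linear_solS a b n :
  INR (S n) * linear_sol a b (S n) = - indicial a b n * linear_sol a b n.
Proof.
assert (INR (S n) <> 0) by now apply not_0_INR.
change (linear_sol a b (S n))
  with (- (indicial a b n / INR (S n)) * linear_sol a b n).
now field.
Qed.

(** Strong induction on the coefficient. The recurrence for psi expresses a coefficient of psi u
    through lower ones, where psi u may already be replaced by - u'. *)
Lemma linear_sol_log_deriv a b phi : center_manifold_series a b phi ->
  let u : fps := fun n => RtoC (linear_sol a b n) in
  forall n, fps_deriv u n = (- fps_mul (fps_shift (fps_shift phi)) u n)%C.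
Proof.
rewrite center_manifold_seriesP2.
set (psi := fps_shift (fps_shift phi)).
intros (_ & _ & P0 & P1 & HP) u.
assert (Hu : forall n, fps_deriv u n = (- RtoC (indicial a b n) * u n)%C).
{ intros n. unfold fps_deriv, u.
  now rewrite <- RtoC_mult, linear_solS, RtoC_mult, RtoC_opp. }
assert (Hm : forall N n, (n <= N)%nat -> fps_deriv u n = (- fps_mul psi u n)%C).
2: now intros n; apply (Hm n).
induction N as [|N IH]; intros n Hn.
{ replace n with 0%nat by lia. rewrite Hu, fps_mul_0, P0.
  unfold indicial. simpl INR.
  replace (0 * 0 + (a + 1) * 0 + b) with b by ring. ring. }
destruct (Nat.eq_dec n (S N)) as [->|]; [|apply IH; lia].
(* Coefficient 1 is separate because the recurrence for psi only starts at psi_2. *)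
destruct N as [|m].
{ rewrite Hu, fps_mul_Sl, fps_mul_0, P0. unfold fps_shift. rewrite P1.
  assert (H1 : u 1%nat = (- RtoC b)%C).
  { rewrite <- RtoC_opp. unfold u. f_equal. simpl. unfold indicial. simpl. field. }
  assert (H0 : u 0%nat = RtoC 1) by reflexivity.
  rewrite H0, H1. unfold indicial. simpl INR.
  replace (1 * 1 + (a + 1) * 1 + b) with (a + 2 + b) by ring.
  rewrite !RtoC_plus. ring. }
assert (H1 : fps_mul psi u (S m) = (- fps_deriv u (S m))%C).
{ rewrite IH by lia. ring. }
assert (HA : fps_mul (fps_mul psi psi) u m = (- fps_mul psi (fps_deriv u) m)%C).
{ rewrite fps_mul_assoc.
  rewrite (fps_mul_ext psi psi (fps_mul psi u) (fun k => - (1) * fps_deriv u k)%C).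
  - rewrite fps_mul_scalr. ring.
  - auto.
  - intros k Hk. rewrite IH by lia. ring. }
assert (HS : fps_mul (fps_shift psi) u m
             = (- fps_deriv u (S m) - RtoC b * u (S m))%C).
{ rewrite <- H1, fps_mul_Sl, P0. ring. }
assert (HD := fps_deriv_mul psi u m). unfold fps_deriv at 1 in HD.
rewrite H1 in HD.
(* The recurrence for psi, multiplied by u. *)
assert (HSS : fps_mul (fps_shift (fps_shift psi)) u m
  = (fps_mul (fps_mul psi psi) u m + - (RtoC a + 2) * fps_mul (fps_shift psi) u m
     + - (1) * fps_mul (fps_deriv psi) u m)%C).
{ rewrite <- !fps_mul_scall, <- !fps_mul_addl. apply fps_mul_ext; auto.
  intros k _. unfold fps_add. etransitivity; [apply HP|].
  unfold fps_shift. ring. }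
rewrite Hu, !fps_mul_Sl, P0. unfold fps_shift at 1. rewrite P1, HSS, HA, HS.
(* By Leibniz, psi' u = (psi u)' - psi u'. Its psi u' term cancels the one coming from psi^2 u, so
   only coefficients of u remain. *)
replace (fps_mul (fps_deriv psi) u m)
  with (RtoC (INR (S m)) * - fps_deriv u (S m) - fps_mul psi (fps_deriv u) m)%C
  by (rewrite HD; ring).
unfold fps_deriv at 2 3.
assert (Hi : indicial a b (S (S m))
   = b + (a + 2) * INR (S (S m)) + INR (S m) * INR (S (S m))).
{ unfold indicial. rewrite (S_INR (S m)). ring. }
rewrite Hi, !RtoC_plus, !RtoC_mult, RtoC_plus. ring.
Qed.

(** * Convergence and geometric bounds *)

Lemma fps_convergent_geometric (f : fps) :
  fps_convergent f <->
  exists r M, 0 < r /\ forall n, Cmod (f n) * r ^ n <= M.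
Proof.
unfold fps_convergent, fps_radius.
destruct (CV_radius_bounded (fun n => Cmod (f n))) as [Hu Hl].
split.
(* The radius is the supremum of the r for which |f_n| r^n is bounded; if no such r is positive, 0
   is an upper bound. *)
- intros H. apply Classical_Prop.NNPP. intros Hn.
  apply (Rbar_lt_not_le _ _ H), Hl.
  intros r [M HM]. simpl. apply Rnot_lt_le. intros Hr. apply Hn.
  exists r, M. split; auto. intros n.
  eapply Rle_trans; [apply Rle_abs | apply HM].
- intros (r & M & Hr & HM).
  apply Rbar_lt_le_trans with (Finite r); [exact Hr|].
  apply Hu. exists M. intros n.
  rewrite Rabs_pos_eq; auto.
  apply Rmult_le_pos; [apply Cmod_ge_0 | apply pow_le; lra].
Qed.

Lemma Cmod_sum_n_le (f : nat -> C) c n :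
  (forall k, (k <= n)%nat -> Cmod (f k) <= c) ->
  Cmod (sum_n f n) <= INR (S n) * c.
Proof.
induction n as [|n IH]; intros H.
- rewrite sum_O. simpl. rewrite Rmult_1_l. now apply H.
- rewrite sum_Sn, S_INR.
  eapply Rle_trans; [apply (Cmod_triangle (sum_n f n))|].
  assert (Cmod (f (S n)) <= c) by (apply H; lia).
  assert (Cmod (sum_n f n) <= INR (S n) * c) by (apply IH; intros; apply H; lia).
  lra.
Qed.

(** (n+1) u_(n+1) is, up to sign, a sum of n+1 products psi_k u_(n-k), each at most T T^k T^(n-k) =
    T^(n+1) in modulus; the factors n+1 cancel. *)
Lemma fps_log_deriv_bound (psi u : fps) T :
  1 <= T -> (forall n, Cmod (psi n) <= T * T ^ n) -> Cmod (u 0%nat) <= 1 ->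
  (forall n, fps_deriv u n = (- fps_mul psi u n)%C) ->
  forall n, Cmod (u n) <= T ^ n.
Proof.
intros HT Hpsi H0 H.
assert (HN : forall N n, (n <= N)%nat -> Cmod (u n) <= T ^ n).
2: now intros n; apply (HN n).
induction N as [|N IH]; intros n Hn.
- now replace n with 0%nat by lia.
- destruct (Nat.eq_dec n (S N)) as [->|]; [|apply IH; lia].
  assert (Hp : 0 < INR (S N)) by (apply lt_0_INR; lia).
  apply Rmult_le_reg_l with (INR (S N)); auto.
  replace (INR (S N) * Cmod (u (S N))) with (Cmod (fps_deriv u N)).
  2: { unfold fps_deriv. rewrite Cmod_mult, Cmod_R, Rabs_pos_eq; lra. }
  rewrite H, Cmod_opp. apply Cmod_sum_n_le. intros k Hk.
  rewrite Cmod_mult.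
  replace (T ^ S N) with (T * T ^ k * T ^ (N - k)).
  2: { rewrite Rmult_assoc, <- pow_add. simpl. do 2 f_equal. lia. }
  apply Rmult_le_compat; auto using Cmod_ge_0. apply IH. lia.
Qed.

Lemma geometric_bound_shift2 (f : fps) r M :
  0 < r -> (forall n, Cmod (f n) * r ^ n <= M) ->
  exists T, 1 <= T /\
    forall n, Cmod (fps_shift (fps_shift f) n) <= T * T ^ n.
Proof.
intros Hr HM.
assert (Hi : 0 < / r) by now apply Rinv_0_lt_compat.
assert (HM0 : 0 <= M).
{ eapply Rle_trans; [|apply (HM 0%nat)]. simpl. rewrite Rmult_1_r.
  apply Cmod_ge_0. }
assert (0 <= M * / r ^ 2).
{ apply Rmult_le_pos; auto. apply Rlt_le, Rinv_0_lt_compat. now apply pow_lt. }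
(* One constant dominating 1, the ratio 1/r and the prefactor M / r^2. *)
exists (1 + / r + M * / r ^ 2). split; [lra|]. intros n.
apply Rle_trans with (M * / r ^ 2 * (/ r) ^ n).
- unfold fps_shift. rewrite pow_inv.
  assert (Hp := pow_lt r n Hr). assert (Hp2 := pow_lt r 2 Hr).
  specialize (HM (S (S n))).
  replace (r ^ S (S n)) with (r ^ n * r ^ 2) in HM by (simpl; ring).
  apply Rmult_le_reg_r with (r ^ n * r ^ 2); [now apply Rmult_lt_0_compat|].
  eapply Rle_trans; [exact HM|]. apply Req_le. field. lra.
- apply Rmult_le_compat; try lra.
  + apply pow_le. lra.
  + apply pow_incr. lra.
Qed.

(** * Growth of the linear solution near (-2, 0) *)

(** The value is b at n = 0 and a + b + 2 at n = 1. For n >= 2 it is n (n-1) + (a+2) n + b, where n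
    (n-1) dominates. *)
Lemma indicial_neq0_near a b n :
  Rabs (a + 2) < / 4 -> Rabs b < / 4 -> b <> 0 -> a <> - b - 2 ->
  indicial a b n <> 0.
Proof.
intros [Ha1 Ha2]%Rabs_def2 [Hb1 Hb2]%Rabs_def2 Hb Ha.
unfold indicial. destruct n as [|[|n]].
- simpl. lra.
- simpl. lra.
- rewrite !S_INR. assert (Hn := pos_INR n). nra.
Qed.

Lemma linear_sol_neq0 a b n :
  (forall k, indicial a b k <> 0) -> linear_sol a b n <> 0.
Proof.
intros H. induction n as [|n IH]; [simpl; lra|].
intros E. assert (HS := linear_solS a b n). rewrite E, Rmult_0_r in HS.
symmetry in HS. apply Rmult_integral in HS. specialize (H n). lra.
Qed.

Lemma linear_sol_growth a b n :
  Rabs (a + 2) < / 4 -> Rabs b < / 4 -> (2 <= n)%nat ->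
  INR n / 6 * Rabs (linear_sol a b n) <= Rabs (linear_sol a b (S n)).
Proof.
intros [Ha1 Ha2]%Rabs_def2 [Hb1 Hb2]%Rabs_def2 Hn%le_INR.
assert (Hp : 0 < INR (S n)) by (apply lt_0_INR; lia).
assert (HS := f_equal Rabs (linear_solS a b n)).
rewrite !Rabs_mult, Rabs_Ropp, (Rabs_pos_eq (INR (S n))) in HS by lra.
apply Rmult_le_reg_l with (INR (S n)); auto. rewrite HS.
rewrite <- Rmult_assoc. apply Rmult_le_compat_r; [apply Rabs_pos|].
eapply Rle_trans; [|apply Rle_abs].
(* For n >= 2, [indicial] is at least n (n-1) - n/4 - 1/4, which exceeds n (n+1) / 6. *)
rewrite S_INR. unfold indicial. simpl in Hn. nra.
Qed.

(** From a large rank N on, each step multiplies |u_n| by at least 2T, so |u_(N+k)| >= (2T)^k |u_N|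
    with u_N nonzero, which eventually exceeds T^(N+k). *)
Lemma linear_sol_not_geometric a b T :
  Rabs (a + 2) < / 4 -> Rabs b < / 4 -> b <> 0 -> a <> - b - 2 -> 1 <= T ->
  ~ (forall n, Rabs (linear_sol a b n) <= T ^ n).
Proof.
intros Ha Hb Hb0 Hab HT H.
(* 12T makes the growth factor n/6 at least 2T; adding 2 to the rank meets the condition n >= 2. *)
destruct (INR_unbounded (12 * T)) as [N0 HN0].
set (N := (N0 + 2)%nat).
assert (HN : 12 * T <= INR N) by (unfold N; rewrite plus_INR; simpl; lra).
assert (Hg : forall k,
   2 ^ k * T ^ k * Rabs (linear_sol a b N) <= Rabs (linear_sol a b (N + k))).
{ induction k as [|k IH]; [rewrite Nat.add_0_r; simpl; lra|].
  rewrite Nat.add_succ_r.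
  eapply Rle_trans; [|apply linear_sol_growth; auto; unfold N; lia].
  apply Rle_trans with (2 * T * Rabs (linear_sol a b (N + k))).
  - simpl. nra.
  - apply Rmult_le_compat_r; [apply Rabs_pos|].
    rewrite plus_INR. assert (Hk := pos_INR k). lra. }
assert (Hpos : 0 < Rabs (linear_sol a b N)).
{ apply Rabs_pos_lt, linear_sol_neq0. intros k. now apply indicial_neq0_near. }
(* Some k has 2^k > T^N / |u_N|, contradicting 2^k |u_N| <= T^N. *)
destruct (Pow_x_infinity 2) with (b := T ^ N / Rabs (linear_sol a b N) + 1)
  as [k Hk].
{ rewrite Rabs_pos_eq; lra. }
specialize (Hk k (le_n k)). rewrite Rabs_pos_eq in Hk by (apply pow_le; lra).
specialize (Hg k). specialize (H (N + k)%nat). rewrite pow_add in H.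
assert (HTk : 0 < T ^ k) by (apply pow_lt; lra).
assert (H1 : 2 ^ k * Rabs (linear_sol a b N) <= T ^ N).
{ apply Rmult_le_reg_r with (T ^ k); auto. lra. }
apply Rge_le, (Rmult_le_compat_r (Rabs (linear_sol a b N))) in Hk; [|lra].
rewrite Rmult_plus_distr_r in Hk. unfold Rdiv in Hk.
rewrite Rmult_assoc, Rinv_l in Hk by lra. lra.
Qed.

(** * The rational solution *)

(** Expansion of b x^2 / (1 - b x). *)
Definition rational_series (b : R) : fps :=
  fun n => match n with S (S m) => RtoC (b ^ S m) | _ => RtoC 0 end.

(** Here psi = b / (1 - b x) satisfies psi' = psi^2, so the equation reduces to (1 + (a+2) x) psi =
    b, that is b (a + b + 2) = 0. *)
Lemma rational_series_solution a b : b * (a + b + 2) = 0 ->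
  center_manifold_series a b (rational_series b).
Proof.
intros H. apply center_manifold_seriesP2. do 2 (split; [reflexivity|]).
intros psi.
assert (Hpsi : forall n, psi n = RtoC (b ^ S n)) by reflexivity.
split; [|split].
- rewrite Hpsi. f_equal. ring.
- rewrite Hpsi, <- RtoC_plus, <- RtoC_opp, <- RtoC_mult. f_equal. simpl. lra.
- intros n.
  (* All n+1 terms of the convolution equal b^(n+2), so the sum is the n-th coefficient of psi'. *)
  assert (Hm : fps_mul psi psi n = RtoC (INR (S n) * b ^ S (S n))).
  { unfold fps_mul.
    rewrite (sum_n_ext_loc _ (fun _ => RtoC (b ^ S (S n)))).
    - generalize (b ^ S (S n)). intros c. induction n as [|n IH].
      + rewrite sum_O. f_equal. simpl. ring.
      + rewrite sum_Sn, IH, (S_INR (S n)).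
        etransitivity; [symmetry; apply RtoC_plus|]. f_equal. ring.
    - intros k Hk. rewrite !Hpsi, <- RtoC_mult, <- pow_add. do 2 f_equal. lia. }
  rewrite Hm. unfold fps_deriv. rewrite !Hpsi, <- RtoC_plus, <- !RtoC_mult.
  rewrite <- !RtoC_minus. f_equal.
  transitivity (b * (a + b + 2) * b ^ S n - (a + 2) * b ^ S (S n)).
  + simpl. ring.
  + rewrite H. ring.
Qed.

Lemma rational_series_convergent b : fps_convergent (rational_series b).
Proof.
apply fps_convergent_geometric.
assert (Hb := Rabs_pos b).
assert (Hi : 0 < / (1 + Rabs b)) by (apply Rinv_0_lt_compat; lra).
(* The radius 1 / (1 + |b|) stays below 1 / |b| and also covers b = 0. *)
exists (/ (1 + Rabs b)), 1. split; auto.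
assert (H1 : / (1 + Rabs b) <= 1).
{ rewrite <- Rinv_1. apply Rinv_le_contravar; lra. }
intros [|[|n]]; simpl rational_series; try (rewrite Cmod_0; lra).
change (b * b ^ n) with (b ^ S n).
rewrite Cmod_R, <- RPow_abs.
change ((/ (1 + Rabs b)) ^ S (S n))
  with (/ (1 + Rabs b) * (/ (1 + Rabs b)) ^ S n).
replace (Rabs b ^ S n * (/ (1 + Rabs b) * (/ (1 + Rabs b)) ^ S n))
  with (/ (1 + Rabs b) * (Rabs b * / (1 + Rabs b)) ^ S n)
  by (rewrite Rpow_mult_distr; ring).
assert (H2 : 0 <= Rabs b * / (1 + Rabs b) <= 1).
{ split; [apply Rmult_le_pos; lra|].
  apply Rmult_le_reg_r with (1 + Rabs b); [lra|].
  rewrite Rmult_assoc, Rinv_l; lra. }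
assert (H3 := pow_incr _ _ (S n) H2). rewrite pow1 in H3.
assert (H4 := pow_le _ (S n) (proj1 H2)). nra.
Qed.

(** * The equivalence on a square around (-2, 0) *)

Theorem proposition6p1 :
  exists U : R * R -> Prop,
    locally ((-2, 0) : R * R) U /\
    forall a b : R, U (a, b) ->
      forall phi : fps, center_manifold_series a b phi ->
        (fps_convergent phi <-> b = 0 \/ a = - b - 2).
Proof.
(* Balls of the product are squares: membership means |a+2| < 1/4 and |b| < 1/4. *)
exists (ball ((-2, 0) : R * R) (/ 4)). split.
{ exists (mkposreal (/ 4) ltac:(lra)). auto. }
intros a b [Ha Hb] phi Hphi.
unfold ball in Ha, Hb; simpl in Ha, Hb. unfold AbsRing_ball in Ha, Hb.
unfold abs, minus, plus, opp in Ha, Hb; simpl in Ha, Hb.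
replace (a + - -2) with (a + 2) in Ha by ring.
replace (b + - 0) with b in Hb by ring.
split.
- intros (r & M & Hr & HM)%fps_convergent_geometric.
  destruct (geometric_bound_shift2 _ _ _ Hr HM) as (T & HT & Hpsi).
  destruct (Req_dec b 0) as [|Hb0]; auto.
  destruct (Req_dec a (- b - 2)) as [|Hab]; auto.
  destruct (linear_sol_not_geometric a b T); auto.
  intros n. rewrite <- Cmod_R. revert n.
  apply (fps_log_deriv_bound _ (fun n => RtoC (linear_sol a b n)) _ HT Hpsi).
  + simpl. rewrite Cmod_1. lra.
  + now apply linear_sol_log_deriv.
- intros Hab.
  assert (Hs : center_manifold_series a b (rational_series b)).
  { apply rational_series_solution. destruct Hab as [-> | ->]; ring. }
  (* By uniqueness, phi is the rational series and inherits its bound. *)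
  assert (HE := center_manifold_series_unique _ _ _ _ Hphi Hs).
  destruct (proj1 (fps_convergent_geometric _) (rational_series_convergent b))
    as (r & M & Hr & HM).
  apply fps_convergent_geometric. exists r, M. split; auto.
  intros n. rewrite HE. apply HM.
Qed.
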